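(* Let $n\ge 1$ and let $\Delta=(\Delta_{ij})$ be an integer $n\times n$ matrix such that $\det\Delta\neq 0$, $\Delta_{ij}\le 0$ for all $i\ne j$, and there exists a vector $\mathbf r\in\mathbb Z^n$ with $\mathbf r>0$ and $\mathbf r\Delta\ge 0$. Then the number of $\Delta$-recurrent configurations is larger than or equal to $\det\Delta$.
   Context: Vectors are row vectors. $\mathbf r>0$ means $r_i>0$ for all $i$; $\mathbf r\ge \mathbf r'$ means $r_i\ge r'_i$ for all $i$. $\mathscr R(\Delta)=\{\mathbf r\in\mathbb Z^n : \mathbf r>0,\ \mathbf r\Delta\ge 0\}$. $\Delta_i$ is the $i$-th row of $\Delta$. A configuration is a row vector $\mathbf u\in\mathbb Z^n$ with $u_i\ge 0$ for all $i$. A vertex $i\in\{1,\dots,n\}$ is critical for $\mathbf u$ if $u_i\ge\Delta_{ii}$; $\mathbf u$ is stable if no vertex is critical, i.e. $0\le u_i<\Delta_{ii}$ for all $i$. Toppling a critical vertex $i$ replaces $\mathbf u$ by $\mathbf u-\Delta_i$. A sequence of topplings from $\mathbf u$ is a sequence $i_1,\dots,i_k$ such that $i_j$ is critical for $\mathbf u-\Delta_{i_1}-\cdots-\Delta_{i_{j-1}}$ for each $1\le j\le k$; it transforms $\mathbf u$ into $\mathbf u-\sum_{j=1}^k\Delta_{i_j}$. For $\mathbf r\in\mathscr R(\Delta)$, a $(\Delta,\mathbf r)$-recurrent configuration is a stable configuration $\mathbf u$ such that $\mathbf u+\mathbf r\Delta$ can be transformed into $\mathbf u$ by a sequence of topplings.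 The set of $(\Delta,\mathbf r)$-recurrent configurations is the same for all $\mathbf r\in\mathscr R(\Delta)$; its elements are called $\Delta$-recurrent configurations. *)

(* Defs.v *)
From mathcomp Require Import all_boot all_order all_algebra.
From mathcomp Require Import mathcomp_extra boolp classical_sets functions cardinality.
From mathcomp Require Import finmap ring lra zify.

Set Implicit Arguments.
Unset Strict Implicit.
Unset Printing Implicit Defensive.

Import Order.TTheory GRing.Theory Num.Theory.

Local Open Scope classical_set_scope.
Local Open Scope ring_scope.

Definition posr_set {n : nat} (Delta : 'M[int]_n) : set 'rV[int]_n :=
  [set r : 'rV[int]_n | (forall i, 0 < r 0 i) /\ (forall i, 0 <= (r *m Delta) 0 i)].

Definition configuration {n : nat} (u : 'rV[int]_n) : Prop :=
  forall i, 0 <= u 0 i.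

Definition critical {n : nat} (Delta : 'M[int]_n) (u : 'rV[int]_n) (i : 'I_n)
    : bool :=
  Delta i i <= u 0 i.

Definition stable {n : nat} (Delta : 'M[int]_n) (u : 'rV[int]_n) : Prop :=
  configuration u /\ forall i, ~~ critical Delta u i.

Definition topple {n : nat} (Delta : 'M[int]_n) (u : 'rV[int]_n) (i : 'I_n)
    : 'rV[int]_n :=
  u - row i Delta.

Fixpoint toppling_seq {n : nat} (Delta : 'M[int]_n) (u : 'rV[int]_n)
    (s : seq 'I_n) : bool :=
  if s is i :: s' then critical Delta u i && toppling_seq Delta (topple Delta u i) s'
  else true.

Definition transforms {n : nat} (Delta : 'M[int]_n) (u v : 'rV[int]_n) : Prop :=
  exists2 s : seq 'I_n, toppling_seq Delta u s & foldl (topple Delta) u s = v.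

Definition recurrent_wrt {n : nat} (Delta : 'M[int]_n) (r : 'rV[int]_n)
    : set 'rV[int]_n :=
  [set u : 'rV[int]_n | stable Delta u /\ transforms Delta (u + r *m Delta) u].

(* The set [recurrent_wrt Delta r] does not depend on [r] in [posr_set Delta];
   see [recurrentE] below. *)
Definition recurrent {n : nat} (Delta : 'M[int]_n) : set 'rV[int]_n :=
  [set u : 'rV[int]_n | exists2 r, posr_set Delta r & recurrent_wrt Delta r u].

Definition tcount {n : nat} (s : seq 'I_n) : 'rV[int]_n :=
  \row_i (count_mem i s)%:Z.

Lemma tcount_nil n : tcount [::] = 0 :> 'rV[int]_n.
Proof. by apply/rowP => i; rewrite !mxE. Qed.

Lemma tcount_cons n (i : 'I_n) s : tcount (i :: s) = delta_mx 0 i + tcount s.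
Proof.
by apply/rowP => j; rewrite !mxE /= PoszD eq_sym; case: (j == i).
Qed.

Lemma foldl_topple n (Delta : 'M[int]_n) s u :
  foldl (topple Delta) u s = u - tcount s *m Delta.
Proof.
elim: s u => [|i s IHs] u /=; first by rewrite tcount_nil mul0mx subr0.
by rewrite IHs tcount_cons mulmxDl -rowE opprD addrA.
Qed.

Lemma toppling_seq_cat n (Delta : 'M[int]_n) s t u :
  toppling_seq Delta u (s ++ t) =
  toppling_seq Delta u s && toppling_seq Delta (foldl (topple Delta) u s) t.
Proof. by elim: s u => [|i s IHs] u //=; rewrite IHs andbA. Qed.

Lemma toppling_seqD n (Delta : 'M[int]_n) s u v :
  configuration v -> toppling_seq Delta u s -> toppling_seq Delta (u + v) s.
Proof.
move=> v0; elim: s u => [|i s IHs] u //= /andP[ci /IHs].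
rewrite /topple addrAC => ->; rewrite andbT /critical mxE.
by apply: le_trans ci _; rewrite lerDl.
Qed.

Lemma transformsD n (Delta : 'M[int]_n) u v w :
  configuration w -> transforms Delta u v -> transforms Delta (u + w) (v + w).
Proof.
move=> w0 [s us <-]; exists s; first exact: toppling_seqD.
by rewrite !foldl_topple addrAC.
Qed.

Lemma transforms_trans n (Delta : 'M[int]_n) u v w :
  transforms Delta u v -> transforms Delta v w -> transforms Delta u w.
Proof.
move=> [s us sv] [t vt tw]; exists (s ++ t).
  by rewrite toppling_seq_cat us sv vt.
by rewrite foldl_cat sv.
Qed.

(* In a toppling sequence leading to [u], keep only the last [r 0 i] topplings
   of each vertex [i]. *)
Lemma toppling_seq_trim n (Delta : 'M[int]_n) (u r : 'rV[int]_n) (s : seq 'I_n) :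
  (forall i j, i != j -> Delta i j <= 0) -> (forall i, 0 <= r 0 i) ->
  toppling_seq Delta (u + tcount s *m Delta) s ->
  transforms Delta
    (u + (\row_i Num.min (r 0 i) (tcount s 0 i)) *m Delta) u.
Proof.
move=> off r0; elim: s => [_|i s IHs].
  exists [::] => //=; rewrite [X in X *m _](_ : _ = 0) ?mul0mx ?addr0 //.
  by apply/rowP => i; rewrite !mxE /=; apply/min_idPr.
move=> /= /andP[]; set m := \row_i _.
have -> : topple Delta (u + tcount (i :: s) *m Delta) i = u + tcount s *m Delta.
  rewrite /topple tcount_cons mulmxDl -rowE; apply/rowP => j; rewrite !mxE; ring.
move=> ci /IHs; set m' := \row_i _ => tr.
have [le_i|gt_i] := leP (tcount (i :: s) 0 i) (r 0 i); last first.
  suff -> : m = m' by [].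
  apply/rowP => j; move: gt_i; rewrite !mxE /=.
  have [->|] := eqVneq i j; last by move=> ij; rewrite add0n.
  by rewrite /=; lia.
have mE : m = delta_mx 0 i + m'.
  apply/rowP => j; move: le_i; rewrite !mxE /= (eq_sym j i).
  have [->|ij] := eqVneq i j; rewrite ?eqxx /=; first by lia.
  by rewrite add0n add0r.
have step : transforms Delta (u + m *m Delta) (u + m' *m Delta).
  exists [:: i]; last first.
    by rewrite /= /topple mE mulmxDl -rowE; apply/rowP => j; rewrite !mxE; ring.
  rewrite /= andbT; apply: le_trans ci _; rewrite !mxE lerD2l.
  apply: ler_sum => j _; have [->|ji] := eqVneq j i.
    by rewrite [m _ _]mxE (min_idPr le_i).
  by rewrite ler_wnM2r ?off // [m _ _]mxE ge_min lexx orbT.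
exact: transforms_trans step tr.
Qed.

Lemma recurrent_wrt_sub n (Delta : 'M[int]_n) (r r' : 'rV[int]_n) :
  \det Delta != 0 -> (forall i j, i != j -> Delta i j <= 0) ->
  posr_set Delta r -> posr_set Delta r' ->
  recurrent_wrt Delta r `<=` recurrent_wrt Delta r'.
Proof.
move=> det0 off [r0 rD] [r'0 r'D] u [su tru]; split => //.
have trk k : transforms Delta (u + (r *+ k) *m Delta) u.
  elim: k => [|k IHk]; first by rewrite mulr0n mul0mx addr0; exists [::].
  rewrite mulrS mulmxDl addrA; apply: transforms_trans IHk.
  apply: transformsD => // i; elim: (k) => [|l IHl].
    by rewrite mulr0n mul0mx mxE.
  by rewrite mulrS mulmxDl mxE addr_ge0.
pose k := (\max_i `|r' 0%R i|)%N.
have [s us su_eq] := trk k.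
have sE : tcount s = r *+ k.
  move: su_eq; rewrite foldl_topple => /eqP.
  rewrite -addrA addrC -subr_eq0 addrK -mulmxBl => /eqP H.
  apply/eqP; rewrite eq_sym -subr_eq0; apply/eqP.
  have := congr1 (mulmx^~ (\adj Delta)) H.
  rewrite -mulmxA mul_mx_adj mul0mx mul_mx_scalar => /matrixP H'.
  apply/rowP => j; have := H' 0 j; rewrite !mxE => /eqP.
  by rewrite mulf_eq0 (negPf det0) /= => /eqP.
have := @toppling_seq_trim n Delta u r' s off (fun i => ltW (r'0 i)).
rewrite sE => /(_ us).
rewrite (_ : \row_i _ = r') //; apply/rowP => i; rewrite mxE.
apply/min_idPl; rewrite mulmxnE.
have : (`|r' 0%R i| <= k)%N by exact: (leq_bigmax i).
have := r0 i; have := r'0 i.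
rewrite -mulr_natr natz => r'i ri kb; have : r' 0 i <= k%:Z by lia.
by move=> le_k; apply: le_trans le_k _; apply: ler_peMl; rewrite -?gtz0_ge1.
Qed.

Lemma recurrentE n (Delta : 'M[int]_n) (r : 'rV[int]_n) :
  \det Delta != 0 -> (forall i j, i != j -> Delta i j <= 0) ->
  posr_set Delta r -> recurrent Delta = recurrent_wrt Delta r.
Proof.
move=> det0 off rR; apply/seteqP; split=> [u [r' r'R]|u ru]; last by exists r.
exact: recurrent_wrt_sub.
Qed.

Lemma finite_recurrent n (Delta : 'M[int]_n) : finite_set (recurrent Delta).
Proof.
pose N := (\max_i `|Delta i i|)%N.
pose g (w : {ffun 'I_n -> 'I_N.+1}) : 'rV[int]_n := \row_i (w i : nat)%:Z.
apply: (@sub_finite_set _ _ (g @` setT)); last first.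
  exact/finite_image/finite_finset.
move=> u [r _ [[u0 us] _]]; exists [ffun i => inord `|u 0%R i|%N] => //.
apply/rowP => i; rewrite !mxE ffunE inordK; first by have := u0 i; lia.
have : (`|Delta i i| <= N)%N by exact: (leq_bigmax i).
have := us i; have := u0 i; rewrite /critical; lia.
Qed.

(* Main.v *)
(** The condition [r *m Delta >= 0] makes [Delta] satisfy a maximum principle, so
    that, up to the sign of [\det Delta], the adjugate of [Delta] is entrywise
    nonnegative.  Its row sums [w] then satisfy [Delta *m w > 0], and [u *m w] is
    a nonnegative integer which decreases along topplings: every configuration
    can be stabilized.  Starting in a given class modulo the row lattice of
    [Delta] and alternating "add [r *m Delta]" and "stabilize" produces a sequence
    of stable configurations in that class; a repetition in it is a recurrent
    configuration, for a multiple of [r].  Hence each of the [`|\det Delta|]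
    classes contains a recurrent configuration. *)
Require Import Defs.
From mathcomp Require Import all_boot all_order all_algebra.
From mathcomp Require Import mathcomp_extra boolp classical_sets functions cardinality.
From mathcomp Require Import finmap.
From mathcomp Require Import zify.

Set Implicit Arguments.
Unset Strict Implicit.
Unset Printing Implicit Defensive.

Import Order.TTheory GRing.Theory Num.Theory.

Local Open Scope classical_set_scope.
Local Open Scope fset_scope.
Local Open Scope ring_scope.

(** * Maximum principle and nonnegativity of the adjugate *)

Lemma exists_min_ratio (n : nat) (x r : 'rV[int]_n) (i0 : 'I_n) :
  (forall i, 0 < r 0 i) ->
  exists i, forall j, x 0 i * r 0 j <= x 0 j * r 0 i.
Proof.
move=> r0; pose F i : rat := (x 0 i)%:~R / (r 0 i)%:~R.
have [i _ min_i] := @Order.TotalTheory.arg_minP _ _ _ i0 predT F isT.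
exists i => j; have := min_i j isT.
rewrite /F ler_pdivrMr ?ltr0z // mulrAC ler_pdivlMr ?ltr0z //.
by rewrite -!intrM ler_int.
Qed.

(** It suffices to treat an index [i] minimizing [x_i / r_i]. If [x_i < 0] there, entry [i] of
    [r_i x Delta - x_i r Delta] is a sum of two nonnegative terms, one of them positive by the
    strictness hypothesis, which contradicts the off-diagonal signs. *)
Lemma maximum_principle (n : nat) (Delta : 'M[int]_n) (r x : 'rV[int]_n) :
  (forall i j, i != j -> Delta i j <= 0) -> posr_set Delta r ->
  (forall i, 0 <= (x *m Delta) 0 i) ->
  (forall i, 0 < (x *m Delta) 0 i \/ 0 < (r *m Delta) 0 i) ->
  forall i, 0 <= x 0 i.
Proof.
move=> off [r0 rD] xD strict k.
have [i min_i] := exists_min_ratio x k r0.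
suff xi0 : 0 <= x 0 i.
  have := min_i k; have := r0 k; have := r0 i; nia.
rewrite leNgt; apply/negP => xi_lt0.
(* [z] is nonnegative and vanishes at [i], so [(z *m Delta) 0 i <= 0]. *)
pose z := r 0 i *: x - x 0 i *: r.
have zDi : (z *m Delta) 0 i <= 0.
  rewrite mxE; apply: sumr_le0 => j _; have [->|ji] := eqVneq j i.
    by rewrite !mxE [x 0 i * _]mulrC subrr mul0r.
  apply: mulr_ge0_le0; last exact: off.
  by rewrite !mxE subr_ge0 [leRHS]mulrC.
have : (z *m Delta) 0 i = r 0 i * (x *m Delta) 0 i - x 0 i * (r *m Delta) 0 i.
  by rewrite mulmxBl -!scalemxAl !mxE.
have := r0 i; have := xD i; have := rD i; case: (strict i); nia.
Qed.

(** For nonzero determinant this is [|\det Delta|] times the inverse of [Delta]; the sign factor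
    makes both products below nonnegative scalars. *)
Definition absadj (n : nat) (Delta : 'M[int]_n) : 'M[int]_n :=
  Num.sg (\det Delta) *: \adj Delta.

Lemma mul_absadj_mx (n : nat) (Delta : 'M[int]_n) :
  absadj Delta *m Delta = `|\det Delta|%:M.
Proof. by rewrite -scalemxAl mul_adj_mx scale_scalar_mx -normrEsg. Qed.

Lemma mul_mx_absadj (n : nat) (Delta : 'M[int]_n) :
  Delta *m absadj Delta = `|\det Delta|%:M.
Proof. by rewrite -scalemxAr mul_mx_adj scale_scalar_mx -normrEsg. Qed.

(** Row [i] times [Delta] is [|\det Delta|] at [i] and zero elsewhere, so strictness must come from
    the other vector: [r] is replaced by [y + r], where [y] is the sum of the rows and [y *m Delta]
    is positive everywhere. *)
Lemma absadj_ge0 (n : nat) (Delta : 'M[int]_n) (r : 'rV[int]_n) :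
  \det Delta != 0 -> (forall i j, i != j -> Delta i j <= 0) ->
  posr_set Delta r -> forall i j, 0 <= absadj Delta i j.
Proof.
move=> det0 off rR; have [r0 rD] := rR.
have d_gt0 : 0 < `|\det Delta| by rewrite normr_gt0.
pose y : 'rV[int]_n := const_mx 1 *m absadj Delta.
have yD i : (y *m Delta) 0 i = `|\det Delta|.
  by rewrite -mulmxA mul_absadj_mx mul_mx_scalar !mxE mulr1.
have y_ge0 : forall i, 0 <= y 0 i.
  apply: maximum_principle off rR _ _ => i; first by rewrite yD ltW.
  by left; rewrite yD.
have yrD i : 0 < ((y + r) *m Delta) 0 i.
  by rewrite mulmxDl mxE yD ltr_wpDr.
have yrR : posr_set Delta (y + r).
  by split=> i; [rewrite mxE ltr_wpDl | exact: ltW].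
move=> i j.
have rowD k : (row i (absadj Delta) *m Delta) 0 k = `|\det Delta| *+ (i == k).
  by rewrite -row_mul mul_absadj_mx !mxE.
have /(_ j) : forall k, 0 <= row i (absadj Delta) 0 k.
  apply: maximum_principle off yrR _ _ => k; last by right.
  by rewrite rowD mulrn_wge0 // ltW.
by rewrite mxE.
Qed.

(** * Stabilization *)

Lemma topple_configuration (n : nat) (Delta : 'M[int]_n) (u : 'rV[int]_n) i :
  (forall i j, i != j -> Delta i j <= 0) -> configuration u ->
  critical Delta u i -> configuration (topple Delta u i).
Proof.
move=> off u0 ci j; rewrite /topple !mxE subr_ge0.
have [<-|ij] := eqVneq i j; first exact: ci.
exact: le_trans (off _ _ ij) (u0 j).
Qed.

Lemma stabilize (n : nat) (Delta : 'M[int]_n) (r u : 'rV[int]_n) :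
  \det Delta != 0 -> (forall i j, i != j -> Delta i j <= 0) ->
  posr_set Delta r -> configuration u ->
  exists2 v, stable Delta v & transforms Delta u v.
Proof.
move=> det0 off rR.
pose w : 'cV[int]_n := absadj Delta *m const_mx 1.
have w_ge0 i : 0 <= w i 0.
  rewrite mxE; apply: sumr_ge0 => j _.
  by rewrite [const_mx _ _ _]mxE mulr1; exact: absadj_ge0 rR _ _.
have Dw i : (row i Delta *m w) 0 0 = `|\det Delta|.
  by rewrite -row_mul mulmxA mul_mx_absadj mul_scalar_mx !mxE mulr1.
have pot_ge0 v : configuration v -> 0 <= (v *m w) 0 0.
  by move=> v0; rewrite mxE; apply: sumr_ge0 => j _; exact: mulr_ge0.
(* Induction on the potential [u *m w], which each toppling lowers by exactly [|\det Delta|]. *)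
have [m] := ubnP `|(u *m w) 0%R 0%R|%N.
elim: m u => // m IHm u le_m u0.
have [/existsP[i ci]|/existsPn st] := boolP [exists i, critical Delta u i];
  last by exists u; [split | exists [::]].
have tu0 := topple_configuration off u0 ci.
have [|v stv tv] := IHm (topple Delta u i) _ tu0.
  have tw : (topple Delta u i *m w) 0 0 = (u *m w) 0 0 - `|\det Delta|.
    by rewrite /topple mulmxBl -(Dw i) mxE; congr (_ + _); rewrite mxE.
  have : 0 < `|\det Delta| by rewrite normr_gt0.
  have := pot_ge0 _ u0; have := pot_ge0 _ tu0; move: le_m.
  rewrite tw; lia.
exists v => //; apply: transforms_trans tv.
by exists [:: i]; rewrite /= ?ci.
Qed.

(** * Recurrent configurations in every class modulo the row lattice *)

Lemma transforms_mod (n : nat) (Delta : 'M[int]_n) (u v : 'rV[int]_n) :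
  transforms Delta u v -> exists c, v = u + c *m Delta.
Proof.
by case=> s _ <-; exists (- tcount s); rewrite foldl_topple mulNmx.
Qed.

(** Pigeonhole: entries of stable configurations are at most [N], so [inord] loses nothing and [g]
    takes values in a finite type. *)
Lemma stable_repetition (n : nat) (Delta : 'M[int]_n) (v : nat -> 'rV[int]_n) :
  (forall k, stable Delta (v k)) -> exists a b, (a < b)%N /\ v a = v b.
Proof.
move=> stv; pose N := (\max_i `|Delta i i|)%N.
pose T := {ffun 'I_n -> 'I_N.+1}.
pose g (k : 'I_#|T|.+1) : T := [ffun i => inord `|v k 0%R i|%N].
have gE k l : g k = g l -> v k = v l.
  move=> /ffunP gkl; apply/rowP => i; have := gkl i; rewrite !ffunE.
  have bnd m : (`|v m 0%R i| < N.+1)%N.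
    have : (`|Delta i i| <= N)%N by exact: (leq_bigmax i).
    have [v0 /(_ i)] := stv m; have := v0 i; rewrite /critical; lia.
  move=> /(congr1 val); rewrite /= !inordK ?bnd //.
  have := (stv k).1 i; have := (stv l).1 i; lia.
have : ~~ injectiveb g.
  by apply/negP => /injectiveP /leq_card; rewrite card_ord ltnn.
move=> /injectivePn[k [l kl /gE vkl]].
case: (ltngtP k l) => [lt_kl|lt_lk|/val_inj kl_eq].
- by exists k, l.
- by exists l, k.
- by rewrite kl_eq eqxx in kl.
Qed.

Lemma recurrent_of_configuration (n : nat) (Delta : 'M[int]_n)
    (r u : 'rV[int]_n) :
  \det Delta != 0 -> (forall i j, i != j -> Delta i j <= 0) ->
  posr_set Delta r -> configuration u ->
  exists2 v, recurrent Delta v & exists c, v = u + c *m Delta.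
Proof.
move=> det0 off rR u0; have [r0 rD] := rR.
have [st stP] : {st : 'rV[int]_n -> 'rV[int]_n & forall x, configuration x ->
    stable Delta (st x) /\ transforms Delta x (st x)}.
  apply: (@choice _ _ (fun x y => configuration x ->
    stable Delta y /\ transforms Delta x y)) => x; have [x0|nx0] := pselect (configuration x).
    by have [y ? ?] := stabilize det0 off rR x0; exists y.
  (* Arbitrary value: [st] is only applied to configurations. *)
  by exists x.
pose v := fix v k := if k is k'.+1 then st (v k' + r *m Delta) else st u.
have rD_cfg x : configuration x -> configuration (x + r *m Delta).
  by move=> x0 i; rewrite mxE addr_ge0.
have stv k : stable Delta (v k).
  elim: k => [|k [IHk _]] /=; first exact: (stP _ u0).1.
  exact: (stP _ (rD_cfg _ IHk)).1.
have v_step k : transforms Delta (v k + r *m Delta) (v k.+1).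
  exact: (stP _ (rD_cfg _ (stv k).1)).2.
have v_mod k : exists c, v k = u + c *m Delta.
  elim: k => [|k [c vk]]; first exact: transforms_mod (stP _ u0).2.
  have [c' ->] := transforms_mod (v_step k); exists (c + r + c').
  by rewrite vk !mulmxDl !addrA.
(* All [k] additions can be made at once, since toppling sequences stay legal when a nonnegative
   vector is added. *)
have v_iter a k : transforms Delta (v a + (r *+ k) *m Delta) (v (a + k)%N).
  elim: k => [|k IHk].
    by rewrite mulr0n mul0mx addr0 addn0; exists [::].
  rewrite mulrSr mulmxDl addrA addnS; apply: transforms_trans (v_step _).
  exact: transformsD.
have [a [b [lt_ab v_ab]]] := stable_repetition stv.
exists (v a); last exact: v_mod.
(* From time [a] to time [b] the vector [r *m Delta] is added [b - a > 0] times. *)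
exists (r *+ (b - a)); last first.
  by split; [exact: stv | have := v_iter a (b - a)%N; rewrite subnKC -?v_ab // ltnW].
split=> i; first by rewrite mulmxnE pmulrn_lgt0 ?subn_gt0.
by rewrite -scaler_nat -scalemxAl mxE mulr_ge0 ?ler0n.
Qed.

Lemma recurrent_representative (n : nat) (Delta : 'M[int]_n)
    (r u : 'rV[int]_n) :
  \det Delta != 0 -> (forall i j, i != j -> Delta i j <= 0) ->
  posr_set Delta r ->
  exists2 v, recurrent Delta v & exists c, v = u + c *m Delta.
Proof.
move=> det0 off rR.
(* The lattice vector [a *m absadj Delta *m Delta] adds [|\det Delta| * |u_i| >= |u_i|] to each
   [u_i]. *)
pose a : 'rV[int]_n := \row_i `|u 0 i|.
have cfg : configuration (u + (a *m absadj Delta) *m Delta).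
  move=> i; rewrite -mulmxA mul_absadj_mx mul_mx_scalar !mxE.
  rewrite -lerBlDl sub0r; apply: le_trans (ler_norm _) _; rewrite normrN.
  by apply: ler_peMl; rewrite // -gtz0_ge1 normr_gt0.
have [v vR [c vE]] := recurrent_of_configuration det0 off rR cfg.
exists v => //; exists (a *m absadj Delta + c).
by rewrite vE mulmxDl addrA.
Qed.

(** * Counting the classes *)

(* In Smith normal form the lattice becomes [\prod_i d_i Z]. *)
Lemma inequivalent_representatives (n : nat) (Delta : 'M[int]_n) :
  exists (T : finType) (f : T -> 'rV[int]_n),
    #|T| = `|\det Delta|%N /\
    forall s t c, f s = f t + c *m Delta -> s = t.
Proof.
have [L Lu [R Ru [d _ DE]]] := int_Smith_normal_form Delta.
set S := \matrix_(i, j) _ in DE.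
have unit_abs (A : 'M[int]_n) : A \in unitmx -> `|\det A|%N = 1%N.
  by rewrite unitmxE => /orP[] /eqP ->.
have SE : S = diag_mx (\row_i nth 0 d i).
  by apply/matrixP => i j; rewrite !mxE.
(* The box of integer points with [0 <= s_i < |d_i|]; its size is [|\det Delta|] because [L] and [R]
   have determinant 1 or -1. *)
pose T := {dffun forall i : 'I_n, 'I_`|nth 0%R d i|%N}.
exists T, (fun s : T => (\row_i (s i : nat)%:Z) *m R); split.
  rewrite card_dep_ffun foldrE big_image /= DE !det_mulmx !abszM.
  rewrite (unit_abs L) // (unit_abs R) // mul1n muln1 SE det_diag.
  rewrite (big_morph absz abszM absz1).
  by apply: eq_bigr => i _; rewrite card_ord mxE.
move=> s t c; rewrite {}DE => /(congr1 (mulmx^~ (invmx R))).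
rewrite !mulmxA -mulmxDl !mulmxK // => /rowP E.
apply/ffunP => i; apply: val_inj => /=.
have := E i; rewrite SE mul_mx_diag [LHS]mxE [RHS]mxE [in RHS]mxE.
rewrite [X in _ = _ + X]mxE [X in _ * X]mxE; move: ((c *m L) 0 i) => q.
have := ltn_ord (s i); have := ltn_ord (t i).
move: (nat_of_ord (s i)) (nat_of_ord (t i)) => a b.
move: (nth 0 d i) => e.
(* Here [a - b = q * e] while [|a - b| < |e|], which forces [q = 0]. *)
have [->|] := eqVneq q 0; first by lia.
nia.
Qed.

Theorem corollary3p7 (n : nat) (Delta : 'M[int]_n) (n_ge1 : (1 <= n)%N)
    (det_neq0 : \det Delta <> 0)
    (offdiag_le0 : forall i j : 'I_n, i <> j -> Delta i j <= 0)
    (exists_r : exists r : 'rV[int]_n, posr_set Delta r) :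
  \det Delta <= #|` fset_set (recurrent Delta)|%:Z.
Proof.
have det0 : \det Delta != 0 by apply/eqP.
have off i j : i != j -> Delta i j <= 0 by move=> /eqP; exact: offdiag_le0.
have [r rR] := exists_r.
have [T [f [cardT f_inj]]] := inequivalent_representatives Delta.
(* One recurrent configuration is chosen in the class of each [f t]; distinct classes give distinct
   choices. *)
have [F FP] : {F : T -> 'rV[int]_n & forall t,
    recurrent Delta (F t) /\ exists c, F t = f t + c *m Delta}.
  apply: (@choice _ _ (fun t v =>
    recurrent Delta v /\ exists c, v = f t + c *m Delta)) => t.
  by have [v ? ?] := recurrent_representative (f t) det0 off rR; exists v.
have F_inj : injective F.
  move=> s t Fst; have [_ [c Fs]] := FP s; have [_ [c' Ft]] := FP t.
  apply: (f_inj s t (c' - c)); rewrite mulmxBl addrA -Ft -Fst Fs.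
  by rewrite addrK.
(* The bound obtained is in fact [|\det Delta|]. *)
apply: le_trans (ler_norm _) _; rewrite -abszE lez_nat -cardT.
rewrite cardE -(size_map F); apply: uniq_leq_size.
  by rewrite map_inj_uniq ?enum_uniq.
move=> x /mapP[t _ ->]; rewrite in_fset_set; last exact: finite_recurrent.
exact/mem_set/(FP t).1.
Qed.
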